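(* Every finite nonempty point set $S\subset\mathbb{R}^2$ in convex position admits a plane straight-line spanning path that is $\frac{3\pi}{2}$-open. Moreover, this bound is best possible: for every $\varepsilon>0$ there exists a finite point set $S\subset\mathbb{R}^2$ in convex position such that every plane straight-line spanning path $P$ of $S$ satisfies $\mathrm{op}(P)<\frac{3\pi}{2}+\varepsilon$.
   Context: A finite set $S\subset\mathbb{R}^2$ is in convex position if every point of $S$ is a vertex (extreme point) of the convex hull of $S$; in particular no three points of $S$ are collinear. A plane straight-line graph $G=(S,E)$ on $S$ has vertex set $S$, its edges are straight-line segments connecting two points of $S$, and two edges do not intersect except possibly at common endpoints. A plane straight-line spanning path of $S$ is a plane straight-line graph on $S$ that is a path visiting every point of $S$ exactly once. The incident angles of $p\in S$ in $G$ are the angles between two edges of $G$ that appear consecutively in the circular order of the edges incident to $p$ (so a vertex of degree two has two incident angles, summing to $2\pi$). The openness $\mathrm{op}_G(p)$ of $p$ in $G$ is the maximum incident angle of $p$ in $G$; if $p$ has degree at most one, set $\mathrm{op}_G(p)=2\pi$. The openness of $G$ is $\mathrm{op}(G)=\min_{p\in S}\mathrm{op}_G(p)$, and $G$ is called $\varphi$-open if $\mathrm{op}(G)\ge\varphi$. *)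

(* Defs.v *)
From HB Require Import structures.
From mathcomp Require Import all_boot all_order all_algebra finmap.
From mathcomp Require Import interval_inference.
From mathcomp Require Import all_classical all_reals trigo convex.

Set Implicit Arguments.
Unset Strict Implicit.
Unset Printing Implicit Defensive.

Import Order.TTheory GRing.Theory Num.Theory.

Local Open Scope classical_set_scope.
Local Open Scope ring_scope.
Local Open Scope convex_scope.

Definition plane (R : realType) := 'rV[R]_2.

Section ConvexPosition.
Variable R : realType.
Implicit Types (A : set (plane R)) (S : {fset plane R}).

Definition conv_comb (t : {i01 R}) (a b : plane R) : plane R :=
  (a : convex_lmodType (plane R)) <| t |> b.

Definition convex_hull A : set (plane R) :=
  smallest (@convex_set R (plane R)) A.

Definition extreme_point A (x : plane R) : Prop :=
  A x /\
  forall (a b : plane R) (t : {i01 R}), A a -> A b ->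
    0 < t%:num < 1 -> x = conv_comb t a b -> a = x /\ b = x.

Definition convex_position S : Prop :=
  forall p : plane R, p \in S ->
    extreme_point (convex_hull [set` S]) p.

Definition segment (a b : plane R) : set (plane R) :=
  [set conv_comb t a b | t in [set: {i01 R}]].

End ConvexPosition.

Section Angle.
Variable R : realType.
Implicit Types u v p q r : plane R.

Definition dot u v : R := \sum_i u 0 i * v 0 i.

Definition enorm u : R := Num.sqrt (dot u u).

Definition cross u v : R := u 0 0 * v 0 1 - u 0 1 * v 0 0.

(* Counterclockwise angle in [0, 2 pi) by which the direction of u must be
   rotated to obtain the direction of v; meaningful for u and v nonzero.
   acos gives the unoriented angle in [0, pi]. *)
Definition ccw_angle u v : R :=
  let theta := acos (dot u v / (enorm u * enorm v)) in
  if 0 <= cross u v then theta else 2 * pi - theta.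

Definition ccw_angle_at p q r : R := ccw_angle (q - p) (r - p).

End Angle.

(* A straight-line graph on S is given by its adjacency relation e; the edge
   {a, b} is drawn as the segment from a to b. *)
Section GeometricGraph.
Variables (R : realType) (S : {fset plane R}).
Implicit Types (e : rel S) (a b c d p q r : S).

Definition plane_graph e : Prop :=
  [/\ symmetric e, irreflexive e &
      forall a b c d, e a b -> e c d ->
        [set val a; val b] <> [set val c; val d] ->
        segment (val a) (val b) `&` segment (val c) (val d) `<=`
          [set val a; val b] `&` [set val c; val d]].

Definition is_spanning_path e : Prop :=
  exists s : seq S,
    [/\ uniq s, forall p, p \in s &
        forall p q, e p q = infix [:: p; q] s || infix [:: q; p] s].

Definition plane_spanning_path e : Prop :=
  plane_graph e /\ is_spanning_path e.

Definition degree e p : nat := #|[pred q | e p q]|.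

(* The edge pr comes immediately after the edge pq in the counterclockwise
   order of the edges at p.  If p has exactly two neighbours, each of them
   follows the other one, so there are two incident angles at p. *)
Definition consecutive e p q r : bool :=
  [&& e p q, e p r, q != r &
      ~~ [exists x : S, e p x &&
            (0 < ccw_angle_at (val p) (val q) (val x)
               < ccw_angle_at (val p) (val q) (val r))]].

(* The default value 0 of the maximum is harmless, as angles are nonnegative. *)
Definition openness_at e p : R :=
  if (degree e p <= 1)%N then 2 * pi
  else \big[Num.max/0]_(qr : S * S | consecutive e p qr.1 qr.2)
         ccw_angle_at (val p) (val qr.1) (val qr.2).

(* All values openness_at e p are at most 2 * pi, so for nonempty S this is
   their minimum. *)
Definition openness e : R := \big[Num.min/2 * pi]_(p : S) openness_at e p.

Definition phi_open (phi : R) e : Prop := phi <= openness e.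

End GeometricGraph.

(* Main.v *)
(* Number the points P_0, ..., P_{n-1} counterclockwise, with indices modulo n.
   For each residue k the edges P_i P_j with i + j in {k, k + 1} form a plane
   zigzag path, and its angles are angles P_j P_i P_{j+1} with i + j = k.  All
   angles at P_i add up to less than pi, so at most one of them is obtuse; hence
   each vertex spoils at most one of the n zigzags.  The point a farthest from a
   fixed point b spoils none: in a triangle abc the angle at a is acute because
   |ab| >= |bc|, and no angle P_j a P_{j+1} contains b in its interior.  So some
   zigzag has no obtuse angle.

   For the upper bound take a kite with short diagonal AC, one apex B very far
   away and the other one D very close to AC.  The angles at A and at C spanned
   with B and all angles at D are nearly right or larger, and every Hamiltonian
   path on A, B, C, D uses one of them. *)

Require Import Defs.
From mathcomp Require Import all_boot all_order all_algebra finmap.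
From mathcomp Require Import all_classical all_reals trigo.
From mathcomp Require Import convex interval_inference zify ring lra.

Set Implicit Arguments.
Unset Strict Implicit.
Unset Printing Implicit Defensive.

Import Order.TTheory GRing.Theory Num.Theory.
Local Open Scope ring_scope.

(** * Dot and cross products, angles *)

Section PlaneGeometry.
Variable R : realType.
Implicit Types (u v w : plane R) (t c : R).

Lemma dotE u v : dot u v = u 0 0 * v 0 0 + u 0 1 * v 0 1.
Proof.
rewrite /dot !big_ord_recl big_ord0 addr0.
by congr (_ + u 0 _ * v 0 _); apply/val_inj.
Qed.

Lemma plane_eqP u v : u 0 0 = v 0 0 -> u 0 1 = v 0 1 -> u = v.
Proof.
move=> e0 e1; apply/rowP => i; case: i => [[|[|i]] lti] //.
  by rewrite (_ : Ordinal lti = 0) //; apply/val_inj.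
by rewrite (_ : Ordinal lti = 1) //; apply/val_inj.
Qed.

Lemma dot_ge0 u : 0 <= dot u u.
Proof. by rewrite dotE addr_ge0 // -expr2 sqr_ge0. Qed.

Lemma dot_gt0 u : u != 0 -> 0 < dot u u.
Proof.
move=> u_neq0; rewrite lt_neqAle dot_ge0 andbT; apply: contra_neq u_neq0.
rewrite dotE -!expr2 => /esym/eqP; rewrite paddr_eq0 ?sqr_ge0 // !sqrf_eq0.
by case/andP=> /eqP u0 /eqP u1; apply: plane_eqP; rewrite mxE.
Qed.

Lemma dotC u v : dot u v = dot v u.
Proof. by rewrite !dotE; ring. Qed.

Lemma crossC u v : cross u v = - cross v u.
Proof. by rewrite /cross; ring. Qed.

Lemma crossuu u : cross u u = 0.
Proof. by rewrite /cross; ring. Qed.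

Lemma enorm_ge0 u : 0 <= enorm u.
Proof. exact: sqrtr_ge0. Qed.

Lemma enorm_sqr u : enorm u ^+ 2 = dot u u.
Proof. by rewrite sqr_sqrtr ?dot_ge0. Qed.

Lemma enorm_gt0 u : u != 0 -> 0 < enorm u.
Proof. by move=> u0; rewrite sqrtr_gt0 dot_gt0. Qed.

Lemma Cauchy_Schwarz u v : `|dot u v| <= enorm u * enorm v.
Proof.
rewrite -(@ler_pXn2r _ 2) ?nnegrE ?mulr_ge0 ?enorm_ge0 //.
rewrite exprMn !enorm_sqr real_normK ?num_real // -subr_ge0.
rewrite (_ : _ - _ = cross u v ^+ 2) ?sqr_ge0 //.
by rewrite !dotE /cross; ring.
Qed.

Lemma cos_between_bound u v : -1 <= dot u v / (enorm u * enorm v) <= 1.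
Proof.
rewrite -ler_norml normrM normfV (ger0_norm (mulr_ge0 _ _)) ?enorm_ge0 //.
have [->|n0] := eqVneq (enorm u * enorm v) 0; first by rewrite invr0 mulr0.
by rewrite ler_pdivrMr ?mul1r ?Cauchy_Schwarz // lt_neqAle eq_sym n0 mulr_ge0 ?enorm_ge0.
Qed.

Lemma acos_lt_cos t c : -1 <= t <= 1 -> 0 <= c <= pi -> (t < cos c) = (c < acos t).
Proof.
move=> t1 cpi; rewrite -{1}(acosK (x := t)) ?in_itv //.
by rewrite ltr_cos // in_itv //= acos_ge0 ?acos_lepi.
Qed.

Lemma ccw_angle_ge u v :
  0 <= dot u v -> cross u v < 0 -> 3 * pi / 2 <= ccw_angle u v.
Proof.
move=> duv cuv; rewrite /ccw_angle (leNgt 0) cuv /=.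
suff : acos (dot u v / (enorm u * enorm v)) <= pi / 2 by lra.
have pi0 := pi_gt0 R.
have half_pi : 0 <= (pi / 2 : R) <= pi by apply/andP; split; lra.
rewrite leNgt -(acos_lt_cos (cos_between_bound u v) half_pi) cos_pihalf -leNgt.
by rewrite divr_ge0 ?mulr_ge0 ?enorm_ge0.
Qed.

(** Both branches obey the bound: the unoriented angle is at most pi < 2 pi - c, and it exceeds [c],
    so its complement to 2 pi is below 2 pi - c. *)
Lemma ccw_angle_lt u v c :
  u != 0 -> v != 0 -> 0 <= c < pi -> dot u v < cos c * (enorm u * enorm v) ->
  ccw_angle u v < 2 * pi - c.
Proof.
move=> u0 v0 /andP[c0 cpi] duv; have bnd := cos_between_bound u v.
have : c < acos (dot u v / (enorm u * enorm v)).
  have c0pi : 0 <= c <= pi by rewrite c0 ltW.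
  by rewrite -(acos_lt_cos bnd c0pi) ltr_pdivrMr ?mulr_gt0 ?enorm_gt0.
have := acos_lepi bnd.
by rewrite /ccw_angle; case: ifP => _; lra.
Qed.

Lemma ccw_anglexx u : u != 0 -> ccw_angle u u = 0.
Proof.
move=> u0; rewrite /ccw_angle crossuu lexx -expr2 enorm_sqr divff ?acos1 //.
by rewrite gt_eqF ?dot_gt0.
Qed.

(* For directions in counterclockwise order within a half-plane, the cotangent
   of the angle from a fixed one is decreasing. *)
Lemma obtuse_widen u v w :
  u != 0 -> 0 < cross u v -> 0 <= cross v w -> 0 < cross u w ->
  dot u v < 0 -> dot u w < 0.
Proof.
move=> u0 uv vw uw duv.
have e : dot u w * cross u v = dot u v * cross u w - dot u u * cross v w.
  by rewrite !dotE /cross; ring.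
have := dot_gt0 u0 => uu.
rewrite -(pmulr_llt0 _ uv) e subr_lt0.
by apply: (@lt_le_trans _ _ 0); rewrite ?nmulr_rlt0 // mulr_ge0 // ltW.
Qed.

(** Two disjoint obtuse angles would sum to more than pi, against [0 < cross u1 u4]. The case
    [cross u2 u3 = 0] admits angles with a common side. *)
Lemma two_obtuse u1 u2 u3 u4 : u1 != 0 -> u3 != 0 ->
  0 < cross u1 u2 -> 0 <= cross u2 u3 -> 0 < cross u1 u3 -> 0 < cross u3 u4 ->
  0 < cross u1 u4 -> dot u1 u2 < 0 -> dot u3 u4 < 0 -> False.
Proof.
move=> n1 n3 c12 c23 c13 c34 c14 d12 d34.
have d13 := obtuse_widen n1 c12 c23 c13 d12.
have : 0 < dot u3 u3 * cross u1 u4 by rewrite mulr_gt0 ?dot_gt0.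
(* The addition formula for the sine, scaled by norms; both terms on the right are negative. *)
rewrite (_ : _ * _ = cross u1 u3 * dot u3 u4 + dot u1 u3 * cross u3 u4); last first.
  by rewrite !dotE /cross; ring.
apply/negP; rewrite -leNgt -oppr_ge0 opprD -mulrN -mulNr.
by rewrite addr_ge0 // mulr_ge0 ?oppr_ge0 // ltW.
Qed.

(** The angle from [v] to [w] is part of the acute angle from [u] to [w]. The next lemma is the
    mirror image. *)
Lemma acute_narrow u v w : w != 0 ->
  0 <= cross u v -> 0 < cross v w -> 0 < cross u w -> 0 < dot u w -> 0 <= dot v w.
Proof.
move=> w0 uv vw uw duw; have ww := dot_gt0 w0.
have e : dot v w * cross u w = dot u w * cross v w + dot w w * cross u v.
  by rewrite !dotE /cross; ring.
by rewrite -(pmulr_lge0 _ uw) e addr_ge0 // mulr_ge0 // ltW.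
Qed.

Lemma acute_narrow_l u v w : v != 0 ->
  0 <= cross w u -> 0 < cross v w -> 0 < cross v u -> 0 < dot u v -> 0 <= dot v w.
Proof.
move=> v0 wu vw vu duv; have vv := dot_gt0 v0.
have e : dot v w * cross v u = dot u v * cross v w + dot v v * cross w u.
  by rewrite !dotE /cross; ring.
by rewrite -(pmulr_lge0 _ vu) e addr_ge0 // mulr_ge0 // ltW.
Qed.

(** Expanding the squares gives |w|^2 <= 2 u.w, the law of cosines in the triangle 0, u, w. *)
Lemma farthest_acute u w : w != 0 ->
  dot (w - u) (w - u) <= dot u u -> 0 < dot u w.
Proof.
move=> w0; have := dot_gt0 w0; rewrite !dotE !mxE; lra.
Qed.

End PlaneGeometry.

(** * Graphs of paths *)

Definition path_rel {T : eqType} (s : seq T) : rel T :=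
  fun p q => infix [:: p; q] s || infix [:: q; p] s.

Lemma path_rel_sym (T : eqType) (s : seq T) : symmetric (path_rel s).
Proof. by move=> p q; rewrite /path_rel orbC. Qed.

Lemma infix2P (T : eqType) (x0 : T) (s : seq T) p q :
  reflect (exists2 t, (t.+1 < size s)%N & p = nth x0 s t /\ q = nth x0 s t.+1)
          (infix [:: p; q] s).
Proof.
apply: (iffP (@infixP T [:: p; q] s)) => [[s1 [s2 ->]]|[t lt_t [-> ->]]].
  exists (size s1); first by rewrite !size_cat /=; lia.
  by rewrite !nth_cat ltnn subnn (leq_gtF (leqnSn _)) subSnn.
exists (take t s), (drop t.+2 s).
by rewrite -{1}(cat_take_drop t s) (drop_nth x0) 1?ltnW // (drop_nth x0).
Qed.

Lemma path_rel_nthS (T : eqType) (x0 : T) (s : seq T) t :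
  (t.+1 < size s)%N -> path_rel s (nth x0 s t) (nth x0 s t.+1).
Proof. by move=> lt_t; apply/orP; left; apply/(infix2P x0); exists t. Qed.

Lemma path_rel_edge (T : eqType) (x0 : T) (s : seq T) p q :
  path_rel s p q -> exists2 t, (t.+1 < size s)%N &
    (p = nth x0 s t /\ q = nth x0 s t.+1) \/ (q = nth x0 s t /\ p = nth x0 s t.+1).
Proof.
case/orP=> /(infix2P x0) [t lt_t ?]; exists t => //; [by left | by right].
Qed.

Lemma path_rel_neighbour (T : eqType) (x0 : T) (s : seq T) t q :
  uniq s -> (t < size s)%N -> path_rel s (nth x0 s t) q ->
  exists2 u, (u < size s)%N & (u = t.+1 \/ t = u.+1) /\ q = nth x0 s u.
Proof.
move=> us lt_t /(path_rel_edge x0) [u lt_u [[e ->]|[-> e]]].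
  move/eqP: e; rewrite nth_uniq // 1?ltnW // => /eqP ->.
  by exists u.+1 => //; split; [left|].
move/eqP: e; rewrite nth_uniq // => /eqP ->.
by exists u; [exact: ltnW | split; [right|]].
Qed.

(** * Openness of a vertex with two neighbours *)

Section Openness.
Variables (R : realType) (S : {fset plane R}).
Implicit Types (e : rel S) (s : seq S) (p q r x : S).

Lemma val_subr_neq0 p q : p != q -> val q - val p != 0.
Proof. by apply: contra_neq => /subr0_eq /val_inj. Qed.

Lemma path_rel_irr s : uniq s -> irreflexive (path_rel s).
Proof.
move=> us x; apply/negP => /(path_rel_edge x) [t lt_t].
have : nth x s t != nth x s t.+1 by rewrite nth_uniq ?ltn_eqF // ltnW.
by move=> /eqP n [] [e1 e2]; apply: n; rewrite -e1 -e2.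
Qed.

Lemma openness_at_ge e p q r :
  irreflexive e -> e p q -> e p r -> (forall x, e p x -> x = q \/ x = r) ->
  0 <= dot (val q - val p) (val r - val p) ->
  cross (val q - val p) (val r - val p) != 0 ->
  3 * pi / 2 <= openness_at e p.
Proof.
move=> irr epq epr nbr dqr; have pi0 := pi_gt0 R.
(* Exchanging [q] and [r] if necessary makes the counterclockwise angle from [q] to [r] the reflex
   one. *)
wlog cqr : q r epq epr nbr dqr / cross (val q - val p) (val r - val p) < 0.
  move=> wl; rewrite neq_lt => /orP[] c; first by apply: (wl q r); rewrite // lt_eqF.
  have c' : cross (val r - val p) (val q - val p) < 0 by rewrite crossC oppr_lt0.
  by apply: (wl r q); rewrite ?lt_eqF // 1?dotC // => x /nbr [] ->; [right|left].
move=> _; rewrite /openness_at; case: ifP => _; first lra.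
have qp : p != q by apply: contraTneq epq => ->; rewrite irr.
have qr : q != r by apply: contraTneq cqr => ->; rewrite crossuu ltxx.
apply: (@bigmax_sup _ _ _ _ (q, r)) => /=; last exact: ccw_angle_ge.
rewrite /consecutive epq epr qr /=; apply/existsP => -[x /andP[/nbr [] ->]].
  by rewrite /ccw_angle_at ccw_anglexx ?ltxx // val_subr_neq0.
by rewrite ltxx andbF.
Qed.

(** The hypothesis on the cosine is symmetric in [q] and [r], so it bounds both incident angles. *)
Lemma openness_at_lt e p q r (c : R) :
  irreflexive e -> e p q -> e p r -> q != r -> (forall x, e p x -> x = q \/ x = r) ->
  0 <= c < pi ->
  dot (val q - val p) (val r - val p) <
    cos c * (enorm (val q - val p) * enorm (val r - val p)) ->
  openness_at e p < 2 * pi - c.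
Proof.
move=> irr epq epr nqr nbr cpi dqr.
have qp : p != q by apply: contraTneq epq => ->; rewrite irr.
have rp : p != r by apply: contraTneq epr => ->; rewrite irr.
rewrite /openness_at ifF; last first.
  apply/negbTE; rewrite -ltnNge; apply/card_gt1P.
  by exists q, r; rewrite !inE.
apply: bigmax_lt => [|[x y] /=]; first by have := pi_gt0 R; case/andP: cpi; lra.
case/and4P=> /nbr x_qr /nbr y_qr nxy _.
case: x_qr y_qr nxy => -> [] ->; rewrite ?eqxx // => _.
  by apply: ccw_angle_lt; rewrite ?val_subr_neq0.
by apply: ccw_angle_lt; rewrite ?val_subr_neq0 // dotC [enorm _ * _]mulrC.
Qed.

End Openness.

(** * A planarity criterion for paths *)

Section Planarity.
Variable R : realType.
Implicit Types (a b c d p q x y : plane R).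

(** Twice the signed area of the triangle a b x. *)
Definition orient a b x : R := cross (b - a) (x - a).

Lemma conv_combE (t : {i01 R}) a b :
  conv_comb t a b = t%:num *: a + (1 - t%:num) *: b.
Proof. by []. Qed.

Lemma orient_conv a b c d (t : {i01 R}) :
  orient a b (conv_comb t c d) = t%:num * orient a b c + (1 - t%:num) * orient a b d.
Proof. by rewrite conv_combE /orient /cross !mxE; ring. Qed.

Lemma segmentC a b : segment a b = segment b a.
Proof.
suff sub x y : (segment x y `<=` segment y x)%classic by apply/seteqP.
move=> z [t _ <-]; exists (1 - t%:num)%:i01 => //.
by rewrite !conv_combE /= subKr addrC.
Qed.

Lemma orient_segment a b x : segment a b x -> orient a b x = 0.
Proof.
by case=> t _ <-; rewrite orient_conv /orient /cross !mxE; ring.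
Qed.

Lemma segment_one_side a b c d x :
  segment a b x -> segment c d x -> 0 < orient a b c * orient a b d -> False.
Proof.
move=> /orient_segment abx [t _ e]; move: abx; rewrite -e orient_conv.
have t0 : 0 <= t%:num by []; have t1 : t%:num <= 1 by [].
move: (orient a b c) (orient a b d) => u v e0 uv.
have uu : 0 < u * u by rewrite -expr2 exprn_even_gt0 //=;
  apply: contraTneq uv => ->; rewrite mul0r ltxx.
(* After multiplication by [u] both terms are nonnegative, and they cannot both vanish. *)
have : t%:num * (u * u) + (1 - t%:num) * (u * v) = 0.
  by rewrite -[RHS](mulr0 u) -e0; ring.
have uv_ge0 : 0 <= (1 - t%:num) * (u * v) by rewrite mulr_ge0 ?subr_ge0 // ltW.
have [->|t_neq0] := eqVneq t%:num 0; first by rewrite mul0r subr0 mul1r; lra.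
have : 0 < t%:num * (u * u) by apply: mulr_gt0 => //; rewrite lt0r t_neq0.
lra.
Qed.

Lemma segment_meet_end a b d x :
  segment a b x -> segment b d x -> orient a b d != 0 -> x = b.
Proof.
move=> /orient_segment abx [t _ e]; move: abx; rewrite -e orient_conv.
rewrite {1}/orient crossuu mulr0 add0r => /eqP; rewrite mulf_eq0.
case/orP=> [/eqP t1 _|/eqP ->]; last by rewrite eqxx.
by rewrite conv_combE t1 scale0r addr0 -[t%:num](subKr 1) t1 subr0 scale1r.
Qed.

(** The line through each edge leaves all later vertices strictly on one side, so no later edge
    meets that edge, except the next one at the common vertex. *)
Lemma path_rel_plane (S : {fset plane R}) (x0 : S) (s : seq S) :
  let z t := val (nth x0 s t) in uniq s ->
  (forall t u v, (t.+1 < u < size s)%N -> (t.+1 < v < size s)%N ->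
     0 < orient (z t) (z t.+1) (z u) * orient (z t) (z t.+1) (z v)) ->
  plane_graph (path_rel s).
Proof.
move=> z us side; split; [exact: path_rel_sym | exact: path_rel_irr |].
pose E t := segment (z t) (z t.+1); pose V t : set (plane R) := [set z t; z t.+1]%classic.
have edge (a b : S) : path_rel s a b -> exists2 t, (t.+1 < size s)%N &
    segment (val a) (val b) = E t /\ [set val a; val b]%classic = V t.
  case/(path_rel_edge x0) => t lt_t ab; exists t => //.
  case: ab => -[-> ->] //; split; first exact: segmentC.
  by rewrite /V setUC.
have lt_meet t u x : (t < u)%N -> (u.+1 < size s)%N -> E t x -> E u x -> (V t `&` V u)%classic x.
  move=> tu lt_u xt xu; have [e|ne] := eqVneq u t.+1.
    rewrite e in lt_u xu *.
    have -> : x = z t.+1.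
      (* With [u] and [v] equal, the side condition says that the square of the orientation is
         positive. *)
      apply: segment_meet_end xt xu _; rewrite -sqrf_eq0 gt_eqF // expr2.
      by apply: side; rewrite ltnSn.
    by split; [right | left].
  case: (segment_one_side xt xu).
  by apply: side; lia.
move=> a b c d /edge [t lt_t [-> ->]] /edge [u lt_u [-> ->]] neq x [xt xu].
case: (ltngtP t u) neq => [tu _|ut _|-> //]; first exact: lt_meet.
by rewrite setIC; apply: lt_meet.
Qed.

End Planarity.

(** * Zigzag paths *)

Section Zigzag.
Variables (R : realType) (n : nat) (P : nat -> plane R).
Hypothesis periodicP : forall i, P (i + n)%N = P i.
Hypothesis ccwP : forall i j k, (i < j)%N -> (j < k)%N -> (k < i + n)%N ->
  0 < orient (P i) (P j) (P k).

Lemma orient_rot (a b c : plane R) : orient a b c = orient b c a.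
Proof. by rewrite /orient /cross !mxE; ring. Qed.

Lemma orient_swap (a b c : plane R) : orient b a c = - orient a b c.
Proof. by rewrite /orient /cross !mxE; ring. Qed.

Lemma cross_neq0l (u v : plane R) : 0 < cross u v -> u != 0.
Proof. by apply: contraTneq => ->; rewrite /cross !mxE !mul0r subrr ltxx. Qed.

Lemma cross_neq0r (u v : plane R) : 0 < cross u v -> v != 0.
Proof. by apply: contraTneq => ->; rewrite /cross !mxE !mulr0 subrr ltxx. Qed.

Lemma periodicPM q i : P (q * n + i)%N = P i.
Proof.
by elim: q => [//|q IHq]; rewrite -{}IHq mulSn -addnA addnC periodicP.
Qed.

(* The t-th vertex of the zigzag path all of whose edges ij have i + j = k or
   i + j = k + 1.  Its first t vertices are t consecutive indices around k / 2. *)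
Definition zigzag k t : nat := if odd (k + t) then (k + 1 + t)./2 else (k - t)./2.

(** Within one lap, an index below [lo] or above [hi] forms a counterclockwise triple with [lo] and
    [hi], up to cyclic rotation. *)
Lemma zigzag_outside_orient lo hi x y (m : nat) :
  (lo < hi)%N -> (m <= lo)%N -> (hi < m + n)%N ->
  (m <= x < m + n)%N -> (m <= y < m + n)%N ->
  (x < lo)%N || (hi < x)%N -> (y < lo)%N || (hi < y)%N ->
  0 < orient (P lo) (P hi) (P x) * orient (P lo) (P hi) (P y).
Proof.
move=> lohi mlo him mx my xo yo.
suff pos i : (m <= i < m + n)%N -> (i < lo)%N || (hi < i)%N ->
    0 < orient (P lo) (P hi) (P i) by rewrite mulr_gt0 ?pos.
move=> mi /orP[] io; last by apply: ccwP; lia.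
by rewrite -orient_rot; apply: ccwP; lia.
Qed.

(** The vertices up to position t + 1 fill a block of consecutive indices bounded by the endpoints
    of the current edge; all later ones fall outside it. *)
Lemma zigzag_one_side k t u v : (n <= k)%N ->
  (t.+1 < u < n)%N -> (t.+1 < v < n)%N ->
  0 < orient (P (zigzag k t)) (P (zigzag k t.+1)) (P (zigzag k u)) *
      orient (P (zigzag k t)) (P (zigzag k t.+1)) (P (zigzag k v)).
Proof.
(* The first n zigzag indices lie in the window from m to m + n - 1; [n <= k] keeps the truncated
   subtraction exact. *)
move=> nk tu tv; pose m := ((k - n).+2./2)%N.
have mz w : (w < n)%N -> (m <= zigzag k w < m + n)%N.
  by rewrite /m /zigzag => ?; case: ifP => ?; lia.
have out w : (t.+1 < w < n)%N ->
    (zigzag k w < minn (zigzag k t) (zigzag k t.+1))%N ||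
    (maxn (zigzag k t) (zigzag k t.+1) < zigzag k w)%N.
  rewrite /zigzag => ?; case: ifP => ?; case: ifP => ?; case: ifP => ?; lia.
have neq : zigzag k t != zigzag k t.+1.
  by rewrite /zigzag; case: ifP => ?; case: ifP => ?; lia.
have mzt : (m <= zigzag k t < m + n)%N by apply: mz; lia.
have mzt1 : (m <= zigzag k t.+1 < m + n)%N by apply: mz; lia.
have := out u tu; have := out v tv.
have : (m <= zigzag k u < m + n)%N by apply: mz; lia.
have : (m <= zigzag k v < m + n)%N by apply: mz; lia.
move: (zigzag k u) (zigzag k v) => x y mx my.
case: (ltngtP (zigzag k t) (zigzag k t.+1)) neq => // lt _ oy ox.
  by apply: (@zigzag_outside_orient _ _ _ _ m); lia.
rewrite orient_swap (orient_swap _ _ (P y)) mulrNN.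
by apply: (@zigzag_outside_orient _ _ _ _ m); lia.
Qed.

(** The two indices differ by less than n, so congruence means equality. *)
Lemma zigzag_inj k t u : (n <= k)%N -> (t < n)%N -> (u < n)%N ->
  zigzag k t = zigzag k u %[mod n] -> t = u.
Proof.
move=> nk tn un.
have close : (zigzag k t < zigzag k u + n)%N /\ (zigzag k u < zigzag k t + n)%N.
  by rewrite /zigzag; case: ifP => ?; case: ifP => ?; lia.
have inj : zigzag k t = zigzag k u -> t = u.
  by rewrite /zigzag; case: ifP => ?; case: ifP => ?; lia.
move=> e; apply: inj; move: close.
rewrite (divn_eq (zigzag k t) n) (divn_eq (zigzag k u) n) e.
rewrite -!addnA (addnC _ n) !addnA !ltn_add2r -!mulSnr !ltn_pmul2r; try lia.
by case=> ? ?; congr (_ * _ + _)%N; lia.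
Qed.

(** The index [j] is taken in the lap after [i], so that P_i, P_j, P_{j+1} are in counterclockwise
    order. *)
Definition bad i j :=
  [/\ (i < j)%N, (j.+1 < i + n)%N & dot (P j - P i) (P j.+1 - P i) < 0].

Lemma bad_shift q i j : bad (q * n + i) (q * n + j) -> bad i j.
Proof. by case=> ? ?; rewrite -addnS !periodicPM => ?; split => //; lia. Qed.

Lemma bad_uniq i j j' : bad i j -> bad i j' -> j = j'.
Proof.
wlog lt : j j' / (j < j')%N.
  move=> wl b b'; case: (ltngtP j j') => // l; first exact: wl.
  by apply/esym/wl.
move=> [ij jn d] [ij' jn' d']; exfalso.
have c x y : (i < x)%N -> (x < y)%N -> (y < i + n)%N -> 0 < cross (P x - P i) (P y - P i).
  exact: ccwP.
have cjj' : 0 < cross (P j - P i) (P j' - P i) by apply: c; lia.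
apply: (@two_obtuse _ _ (P j.+1 - P i) (P j' - P i) (P j'.+1 - P i)) d d' => //.
- exact: cross_neq0l cjj'.
- exact: cross_neq0r cjj'.
- by apply: c; lia.
- have [->|ne] := eqVneq j.+1 j'; first by rewrite crossuu.
  by apply/ltW/c; lia.
- by apply: c; lia.
- by apply: c; lia.
Qed.

(** From P_i every other vertex is seen at an acute angle to P_m, and the angle P_j P_i P_{j+1} lies
    on one side of the ray towards P_m, hence inside such an acute angle. *)
Lemma far_not_bad i m j : (i <= m < i + n)%N ->
  (forall x, dot (P x - P m) (P x - P m) <= dot (P i - P m) (P i - P m)) ->
  ~ bad i j.
Proof.
move=> im far [ij jn]; apply/negP; rewrite -leNgt.
have c x y : (i < x)%N -> (x < y)%N -> (y < i + n)%N -> 0 < cross (P x - P i) (P y - P i).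
  exact: ccwP.
have cj : 0 < cross (P j - P i) (P j.+1 - P i) by apply: c; lia.
have acute x : P x - P i != 0 -> 0 < dot (P m - P i) (P x - P i).
  move/farthest_acute; apply; rewrite opprB addrA subrK.
  by apply: le_trans (far x) _; rewrite !dotE !mxE; lra.
have aj := acute _ (cross_neq0l cj); have aj1 := acute _ (cross_neq0r cj).
(* If m = i, the inequality [aj] reads 0 < 0. *)
have [mi|mi] := eqVneq m i.
  by move: aj; rewrite mi subrr dotE !mxE !mul0r addr0 ltxx.
have [mj|jm] := leqP m j.
  apply: (@acute_narrow _ (P m - P i)) => //; first exact: cross_neq0r cj.
    have [->|ne] := eqVneq m j; first by rewrite crossuu.
    by apply/ltW/c; lia.
  by apply: c; lia.
apply: (@acute_narrow_l _ (P m - P i)) => //; first exact: cross_neq0l cj.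
  have [->|ne] := eqVneq j.+1 m; first by rewrite crossuu.
  by apply/ltW/c; lia.
by apply: c; lia.
Qed.

(** Otherwise each residue picks a vertex with a bad angle. Uniqueness of the bad angle makes this
    map injective, hence onto, so it reaches the vertex farthest from P_0, which has no bad
    angle. *)
Lemma exists_acute_zigzag : (0 < n)%N -> exists2 k, (n <= k)%N &
  forall t, (0 < t)%N -> (t.+1 < n)%N ->
    0 <= dot (P (zigzag k t.-1) - P (zigzag k t)) (P (zigzag k t.+1) - P (zigzag k t)).
Proof.
move=> n_gt0; apply: contrapT => none.
have /choice [f fP] (k : 'I_n) : exists i : 'I_n, exists2 j, bad i j & (i + j = k %[mod n])%N.
  have [z [j [bzj zj]]] : exists z j, bad z j /\ (z + j = k %[mod n])%N.
    have [t [t0 tn d]] : exists t, [/\ (0 < t)%N, (t.+1 < n)%N &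
        dot (P (zigzag (k + n) t.-1) - P (zigzag (k + n) t))
            (P (zigzag (k + n) t.+1) - P (zigzag (k + n) t)) < 0].
      apply: contrapT => ok; apply: none; exists (k + n)%N; first exact: leq_addl.
      by move=> t t0 tn; rewrite leNgt; apply/negP => d; apply: ok; exists t.
    (* The two neighbours on the zigzag have consecutive indices. In the odd case these lie below
       the index of the vertex, so [n] is added to enter its next lap. *)
    exists (zigzag (k + n) t); case odd_kt : (odd (k + n + t)).
      have e : zigzag (k + n) t.-1 = (zigzag (k + n) t.+1).+1.
        by rewrite /zigzag; case: ifP => ?; case: ifP => ?; lia.
      exists (zigzag (k + n) t.+1 + n)%N; split.
        split; [| |by rewrite -addSn !periodicP -e dotC];
          by rewrite /zigzag; case: ifP => ?; case: ifP => ?; lia.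
      suff -> : (zigzag (k + n) t + (zigzag (k + n) t.+1 + n) = k + n + n)%N.
        by rewrite !modnDr.
      by rewrite /zigzag; case: ifP => ?; case: ifP => ?; lia.
    have e : zigzag (k + n) t.+1 = (zigzag (k + n) t.-1).+1.
      by rewrite /zigzag; case: ifP => ?; case: ifP => ?; lia.
    exists (zigzag (k + n) t.-1)%N; split.
      split; [| |by rewrite -e];
        by rewrite /zigzag; case: ifP => ?; case: ifP => ?; lia.
    suff -> : (zigzag (k + n) t + zigzag (k + n) t.-1 = k + n)%N by rewrite modnDr.
    by rewrite /zigzag; case: ifP => ?; case: ifP => ?; lia.
  have zE := divn_eq z n; have zltj : (z < j)%N by case: bzj.
  (* Both indices are lowered by the same multiple of n. *)
  exists (Ordinal (ltn_pmod z n_gt0)); exists (j - z %/ n * n)%N => /=.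
    by apply: (@bad_shift (z %/ n)); rewrite -zE subnKC //; lia.
  rewrite -zj -(modnMDl (z %/ n)) -(modnMDl (z %/ n)); congr (_ %% _)%N; lia.
have f_inj : injective f.
  move=> k k' e; have [j bj kj] := fP k; have [j' bj' kj'] := fP k'.
  apply/val_inj; rewrite -[LHS](modn_small (ltn_ord k)) -[RHS](modn_small (ltn_ord k')).
  by rewrite -kj -kj' -e (bad_uniq bj (_ : bad (f k) j')) // e.
pose D x := dot (P x - P 0) (P x - P 0).
have [i _ far] := @arg_maxP _ _ _ (Ordinal n_gt0) xpredT (fun i : 'I_n => D i) isT.
have {}far x : D x <= D i.
  rewrite /D (divn_eq x n) periodicPM.
  exact: (far (Ordinal (ltn_pmod x n_gt0))).
have /codomP [k ik] := injF_onto f_inj i.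
have [j bj _] := fP k; rewrite -ik in bj.
(* The point P_0 needs an index in the lap starting at i: 0 if i = 0, and n otherwise. *)
have [i0|i0] := eqVneq (i : nat) 0%N.
  by apply: (@far_not_bad i 0%N j) bj => //; rewrite i0.
apply: (@far_not_bad i n j) bj; first by have := ltn_ord i; lia.
by move=> x; have := far x; rewrite /D -(periodicP 0).
Qed.

End Zigzag.

(** * Counterclockwise order of points in convex position *)

Section CcwOrder.
Variables (R : realType).
Implicit Types (S : {fset plane R}) (a b c m p u v w : plane R).

Lemma hull_sub S p : p \in S -> convex_hull [set` S]%classic p.
Proof. by move=> pS; apply: sub_gen_smallest. Qed.

Lemma hull_conv (A : set (plane R)) a b (t : {i01 R}) :
  convex_hull A a -> convex_hull A b -> convex_hull A (conv_comb t a b).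
Proof.
move=> ha hb B [cB AB].
have := cB a b t; rewrite !inE; apply; [exact: ha | exact: hb].
Qed.

Lemma hull_mix (A : set (plane R)) a b (t : R) : 0 <= t <= 1 ->
  convex_hull A a -> convex_hull A b -> convex_hull A (t *: a + (1 - t) *: b).
Proof. by case/andP=> t0 t1 ha hb; have := hull_conv (Itv01 t0 t1) ha hb. Qed.

Lemma convex_position_mix S p a m (t : R) :
  convex_position S -> p \in S -> a \in S -> convex_hull [set` S]%classic m ->
  0 < t < 1 -> p = t *: a + (1 - t) *: m -> a = p.
Proof.
move=> cvx pS aS hm /andP[t0 t1] e.
have [_ ext] := cvx p pS.
have := ext a m (Itv01 (ltW t0) (ltW t1)) (hull_sub aS) hm.
by rewrite /= t0 t1 => /(_ isT e) [].
Qed.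

(** Otherwise b would lie in the triangle p a c. *)
Lemma convex_position_triangle S p a b c : convex_position S ->
  p \in S -> a \in S -> b \in S -> c \in S ->
  0 < orient p a b -> 0 < orient p b c -> 0 < orient p a c -> 0 < orient a b c.
Proof.
move=> cvx pS aS bS cS pab pbc pac; rewrite ltNge; apply/negP => abc.
(* Barycentric coordinates of b as signed areas. *)
have bary : orient p a c *: b =
    (- orient a b c) *: p + orient p b c *: a + orient p a b *: c.
  by apply: plane_eqP; rewrite !mxE /orient /cross !mxE; ring.
have sum : orient p a c = - orient a b c + orient p b c + orient p a b.
  by rewrite /orient /cross !mxE; ring.
have ne : a <> b.
  by move=> e; move: pab; rewrite e /orient crossuu ltxx.
apply: ne; move: bary sum pab pbc pac abc.
move: (orient p a c) (orient p b c) (orient p a b) (orient a b c) => D x y z bary sum y0 x0 D0 z0.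
have yz0 : 0 < y - z by lra.
(* The point where the line from a through b meets the segment from p to c. *)
pose m := (- z / (y - z)) *: p + (1 - - z / (y - z)) *: c.
apply: (@convex_position_mix S b a m (x / D)) => //.
- apply: hull_mix; [|exact: hull_sub ..].
  rewrite divr_ge0 ?oppr_ge0 ?(ltW yz0) //= ler_pdivrMr // mul1r; lra.
- by rewrite divr_gt0 //= ltr_pdivrMr // mul1r; lra.
have D_neq0 : D != 0 by rewrite gt_eqF.
apply: (scalerI D_neq0); rewrite bary /m sum.
by clear bary; apply: plane_eqP; rewrite !mxE; field; lra.
Qed.

(** An open half-plane with one boundary ray: on it the sign of [cross] is a total preorder by
    angle. *)
Definition lexpos u := (0 < u 0 0) || ((u 0 0 == 0) && (0 < u 0 1)).

Lemma lexpos_cross_trans u v w : lexpos u -> lexpos v -> lexpos w ->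
  0 <= cross u v -> 0 <= cross v w -> 0 <= cross u w.
Proof.
rewrite /lexpos /cross.
move: (u 0 0) (u 0 1) (v 0 0) (v 0 1) (w 0 0) (w 0 1) => u0 u1 v0 v1 w0 w1.
move=> Hu /orP[v_gt0|/andP[/eqP -> v_gt0]] Hw uv vw.
  have uge : 0 <= u0 by case/orP: Hu => [|/andP[/eqP ->]] //; apply: ltW.
  have wge : 0 <= w0 by case/orP: Hw => [|/andP[/eqP ->]] //; apply: ltW.
  (* The identity behind this is v0 * cross u w = u0 * cross v w + w0 * cross u v. *)
  by rewrite -(pmulr_rge0 _ v_gt0); nra.
have w_0 : w0 <= 0 by nra.
have {}Hw : w0 = 0 /\ 0 < w1.
  by case/orP: Hw => [|/andP[/eqP ->]] //; lra.
case: Hw => -> w1_gt0.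
have uge : 0 <= u0 by case/orP: Hu => [|/andP[/eqP ->]] //; apply: ltW.
by rewrite mulr0 subr0 mulr_ge0 // ltW.
Qed.

Lemma lexpos_parallel u v : lexpos u -> lexpos v -> cross u v = 0 ->
  exists2 t : R, 0 < t & u = t *: v.
Proof.
rewrite /lexpos /cross => Hu Hv /subr0_eq e.
case/orP: Hv => [v0|/andP[/eqP v0 v1]].
  exists (u 0 0 / v 0 0).
    rewrite divr_gt0 //; case/orP: Hu => // /andP[/eqP u0 u1].
    by move: e; rewrite u0 mul0r => /esym/eqP; rewrite mulf_eq0 !gt_eqF.
  apply: plane_eqP; rewrite mxE; first by rewrite divfK // gt_eqF.
  by rewrite mulrAC e mulfK // gt_eqF.
move: e; rewrite v0 mulr0 => /eqP; rewrite mulf_eq0 (gt_eqF v1) orbF => u0.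
move: Hu; rewrite (eqP u0) ltxx eqxx /= => u1.
exists (u 0 1 / v 0 1); first exact: divr_gt0.
by apply: plane_eqP; rewrite mxE ?v0 ?(eqP u0) ?mulr0 // divfK // gt_eqF.
Qed.

Lemma exists_lexmin S (x : S) :
  exists p : S, forall q : S, q != p -> lexpos (val q - val p).
Proof.
have [p _ pmin] := @arg_minP _ _ _ x xpredT (fun q : S => val q 0 0) isT.
have [q /eqP q0 qmin] := @arg_minP _ _ _ p (fun q : S => val q 0 0 == val p 0 0)
  (fun q : S => val q 0 1) (eqxx _).
exists q => r rq; rewrite /lexpos !mxE q0 subr_gt0 lt_neqAle pmin // andbT.
rewrite subr_eq0 eq_sym; have [r0|//] := eqVneq (val p 0 0) (val r 0 0).
rewrite /= subr_gt0 lt_neqAle qmin ?r0 // andbT.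
apply: contra_neq rq => r1; apply/val_inj/plane_eqP => //.
by rewrite q0.
Qed.

(** Parallel directions in this half-plane agree, so the nearer of [q] and [r] would lie strictly
    between [p] and the other. *)
Lemma convex_position_not_parallel S p q r : convex_position S ->
  p \in S -> q \in S -> r \in S -> q != r ->
  lexpos (q - p) -> lexpos (r - p) -> orient p q r != 0.
Proof.
move=> cvx pS qS rS qr lq lr; apply/eqP => o0.
have [t t0 e] := lexpos_parallel lq lr o0.
have {}e : q = t *: r + (1 - t) *: p.
  by rewrite scalerBl scale1r addrCA -scalerBr -e subrKC.
case: (ltgtP t 1) => t1.
- move/eqP: qr; apply; apply/esym.
  by apply: (convex_position_mix cvx qS rS (hull_sub pS) _ e); rewrite t0.
- move/eqP: qr; apply.
  apply: (convex_position_mix (t := t^-1) cvx rS qS (hull_sub pS)).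
    by rewrite invr_gt0 t0 invf_lt1.
  rewrite e; apply: plane_eqP; rewrite !mxE; field; lra.
- by move: qr; rewrite e t1 scale1r subrr scale0r addr0 eqxx.
Qed.

(** The points are sorted by angle around the lexicographic minimum [p]. This orders the triples
    through [p]; the triangle lemma gives the others. *)
Lemma exists_ccw_order S : S != fset0 -> convex_position S ->
  exists s : seq S, [/\ uniq s, forall p : S, p \in s &
    forall x0 i j k, (i < j)%N -> (j < k)%N -> (k < size s)%N ->
      0 < orient (val (nth x0 s i)) (val (nth x0 s j)) (val (nth x0 s k))].
Proof.
move=> /fset0Pn [x xS] cvx; have [p pmin] := exists_lexmin [` xS]%fset.
pose le (q r : S) := 0 <= orient (val p) (val q) (val r).
pose l := sort le ([seq q <- enum {: S} | q != p]).
have l_p q : (q \in l) = (q != p) by rewrite mem_sort mem_filter mem_enum andbT.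
have ul : uniq l by rewrite sort_uniq filter_uniq ?enum_uniq.
have le_total : total le.
  move=> q r; rewrite /le /orient (crossC (val r - _)).
  by rewrite oppr_ge0 le_total.
(* The point [p] is related to all points both ways, so transitivity may fail there. *)
have le_trans : {in predC1 p & &, transitive le}.
  by move=> q r s qp rp sp; apply: lexpos_cross_trans; exact: pmin.
have lp : all (predC1 p) l by apply/allP => q; rewrite l_p.
have pw : pairwise le l by rewrite -(sorted_pairwise_in le_trans lp) sort_sorted.
have strict x0 i j : (i < j)%N -> (j < size l)%N ->
    0 < orient (val p) (val (nth x0 l i)) (val (nth x0 l j)).
  move=> ij jl; have il := ltn_trans ij jl.
  rewrite lt0r; move/(pairwiseP x0): pw => /(_ i j il jl ij); rewrite /le => ->.
  rewrite andbT; apply: (convex_position_not_parallel cvx); rewrite ?fsvalP //.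
  - by rewrite (inj_eq val_inj) nth_uniq // ltn_eqF.
  - by apply: pmin; rewrite -l_p mem_nth.
  - by apply: pmin; rewrite -l_p mem_nth.
exists (p :: l); split; first by rewrite /= l_p eqxx ul.
  by move=> q; rewrite inE l_p orbN.
move=> x0 [|i] [|j] [|k] //= ij jk kl; first exact: strict.
apply: (convex_position_triangle (p := val p) cvx); rewrite ?fsvalP //.
all: apply: strict; lia.
Qed.

End CcwOrder.

(** * The open path for points in convex position *)

Section AcutePath.
Variables (R : realType) (S : {fset plane R}).

(** A shift puts i in the first lap; reducing those of j, k that reach the next lap only rotates the
    triple cyclically. *)
Lemma periodic_ccw (x0 : S) (s : seq S) :
  (forall i j k, (i < j)%N -> (j < k)%N -> (k < size s)%N ->
    0 < orient (val (nth x0 s i)) (val (nth x0 s j)) (val (nth x0 s k))) ->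
  let P i := val (nth x0 s (i %% size s)) in
  forall i j k, (i < j)%N -> (j < k)%N -> (k < i + size s)%N ->
    0 < orient (P i) (P j) (P k).
Proof.
set n := size s => ccw P i j k ij jk kin.
have n_gt0 : (0 < n)%N by lia.
pose i0 := (i %% n)%N; pose q := (i %/ n * n)%N.
have iE : i = (q + i0)%N by exact: divn_eq.
have i0n : (i0 < n)%N by rewrite ltn_mod.
have Pq x : P (q + x)%N = P x by rewrite /P /q modnMDl.
have Psmall x : (x < n)%N -> P x = val (nth x0 s x) by move=> xn; rewrite /P modn_small.
have Pbig x : (n <= x)%N -> P x = P (x - n)%N by move=> nx; rewrite /P -{1}(subnK nx) modnDr.
rewrite iE -(subnKC (_ : q <= j)%N) -1?(subnKC (_ : q <= k)%N) ?Pq; [|lia..].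
have ij0 : (i0 < j - q)%N by lia.
have jk0 : (j - q < k - q)%N by lia.
have ki0 : (k - q < i0 + n)%N by lia.
move: (j - q)%N (k - q)%N ij0 jk0 ki0 => {ij jk kin iE} {}j {}k ij jk ki.
case: (ltnP k n) => kn; first by rewrite !Psmall ?ccw //; lia.
rewrite (Pbig k) //; case: (ltnP j n) => jn.
  by rewrite -orient_rot !Psmall ?ccw //; lia.
by rewrite (Pbig j) // orient_rot !Psmall ?ccw //; lia.
Qed.

Lemma degree_end (s : seq S) x0 t : uniq s -> (t < size s)%N ->
  (t == 0)%N || (t.+1 == size s) -> (degree (path_rel s) (nth x0 s t) <= 1)%N.
Proof.
move=> us ts ends; apply/card_le1_eqP => x y; rewrite !inE.
move=> /(path_rel_neighbour us ts) [u us' [ut ->]].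
move=> /(path_rel_neighbour us ts) [v vs' [vt ->]].
have uS : (u < size s)%N := us'; have vS : (v < size s)%N := vs'.
by congr nth; lia.
Qed.

Lemma convex_position_open_path : S != fset0 -> convex_position S ->
  exists e : rel S, plane_spanning_path e /\ phi_open (3 * pi / 2) e.
Proof.
move=> S0 cvx; have [s [us sS ccw]] := exists_ccw_order S0 cvx.
have [x xS] := fset0Pn _ S0; pose x0 : S := [` xS]%fset.
set n := size s; have n_gt0 : (0 < n)%N by rewrite /n; case: (s) (sS x0).
pose P i := val (nth x0 s (i %% n)).
have perP i : P (i + n)%N = P i by rewrite /P modnDr.
have ccwP i j k : (i < j)%N -> (j < k)%N -> (k < i + n)%N -> 0 < orient (P i) (P j) (P k).
  exact: (periodic_ccw (ccw x0)).
have [k nk acute] := exists_acute_zigzag perP ccwP n_gt0.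
pose z := mkseq (fun t => nth x0 s (zigzag k t %% n)) n.
have size_z : size z = n by rewrite size_mkseq.
have valz t : (t < n)%N -> val (nth x0 z t) = P (zigzag k t) by move=> tn; rewrite nth_mkseq.
have uz : uniq z.
  apply/(mkseq_uniqP _ _) => t u; rewrite !inE => tn un /eqP.
  by rewrite nth_uniq ?ltn_mod // => /eqP /(zigzag_inj nk tn un).
have zS p : p \in z.
  have sub : {subset z <= s} by move=> q _; exact: sS.
  by have [_ ->] := uniq_min_size uz sub (eq_leq (esym size_z)).
exists (path_rel z); split; first split.
- apply: (path_rel_plane (x0 := x0)) => // t u v; rewrite size_z => tu tv.
  by rewrite !valz; [exact: (zigzag_one_side ccwP nk tu tv) | lia ..].
- by exists z; split.
apply: le_bigmin => [|p _]; first by have := pi_gt0 R; lra.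
have [t tn <-] : exists2 t, (t < n)%N & nth x0 z t = p.
  by exists (index p z); rewrite ?nth_index // -size_z index_mem.
have [ends|] := boolP ((t == 0)%N || (t.+1 == n)).
  rewrite /openness_at degree_end ?size_z //; by have := pi_gt0 R; lra.
rewrite negb_or => /andP[t0 t1].
have t_gt0 : (0 < t)%N by lia.
have t1n : (t.+1 < n)%N by lia.
apply: (@openness_at_ge _ _ _ _ (nth x0 z t.-1) (nth x0 z t.+1)).
- exact: path_rel_irr.
- rewrite path_rel_sym -{2}(prednK t_gt0) path_rel_nthS // size_z; lia.
- by rewrite path_rel_nthS // size_z.
- move=> y /path_rel_neighbour [//||u _ [ut ->]]; first by rewrite size_z.
  by case: ut => [->|->]; [right | left].
- by rewrite !valz ?acute //; lia.
(* With both later vertices equal, this says that three successive vertices are not collinear. *)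
have := @zigzag_one_side _ _ _ ccwP k t.-1 t.+1 t.+1 nk.
rewrite (prednK t_gt0) ltnSn t1n => /(_ isT isT) side.
rewrite !valz; [|lia ..].
have -> : cross (P (zigzag k t.-1) - P (zigzag k t)) (P (zigzag k t.+1) - P (zigzag k t)) =
    - orient (P (zigzag k t.-1)) (P (zigzag k t)) (P (zigzag k t.+1)).
  by rewrite /orient /cross !mxE; ring.
by rewrite oppr_eq0 -sqrf_eq0 expr2 gt_eqF.
Qed.

End AcutePath.

(** * Kites *)

Section Kite.
Variable R : realType.
Implicit Types (p q r u v : plane R).

Lemma enorm_geP u (m : R) : 0 <= m -> m ^+ 2 <= dot u u -> m <= enorm u.
Proof.
by move=> m0; rewrite -enorm_sqr ler_pXn2r // nnegrE ?enorm_ge0.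
Qed.

Lemma mix_lt (t a b M : R) : 0 < t -> t < 1 -> a <= M -> b <= M ->
  (a < M) || (b < M) -> t * a + (1 - t) * b < M.
Proof.
move=> t0 t1 aM bM /orP[{}aM|{}bM].
  have : 0 < t * (M - a) by rewrite mulr_gt0 ?subr_gt0.
  have : 0 <= (1 - t) * (M - b) by rewrite mulr_ge0 ?subr_ge0 // ltW.
  lra.
have : 0 <= t * (M - a) by rewrite mulr_ge0 ?subr_ge0 // ltW.
have : 0 < (1 - t) * (M - b) by rewrite mulr_gt0 ?subr_gt0.
lra.
Qed.

(** The point p together with the half-plane f < f(p) is convex and contains S, hence the hull; a
    proper combination attaining f(p) has both ends at p. *)
Lemma extreme_linear (S : {fset plane R}) p (a b : R) :
  let f q := a * q 0 0 + b * q 0 1 in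
  p \in S -> (forall q, q \in S -> q != p -> f q < f p) ->
  extreme_point (convex_hull [set` S]%classic) p.
Proof.
move=> f pS fmax; split; first exact: hull_sub.
have f_conv (t : {i01 R}) x y :
    f (conv_comb t x y) = t%:num * f x + (1 - t%:num) * f y.
  by rewrite conv_combE /f !mxE; ring.
have hull_f : (convex_hull [set` S]%classic `<=` [set q | q = p \/ f q < f p])%classic.
  apply: smallest_sub => [|q /= qS].
    apply/convex_setW => x y; rewrite !inE /= => hx hy t t0 t1; rewrite inE /=.
    have := f_conv t x y; rewrite /conv_comb.
    case: hx => [->|hx]; case: hy => [->|hy].
    - by rewrite convmm; left.
    - by move=> ->; right; rewrite mix_lt ?hx ?hy ?orbT // ltW.
    - by move=> ->; right; rewrite mix_lt ?hx ?hy ?orbT // ltW.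
    - by move=> ->; right; rewrite mix_lt ?hx ?hy ?orbT // ltW.
  by have [->|qp] := eqVneq q p; [left | right; apply: fmax].
move=> x y t /hull_f /= hx /hull_f /= hy /andP[t0 t1] e.
have := f_conv t x y; rewrite -e => fe.
have le_fp z : z = p \/ f z < f p -> f z <= f p by case=> [->|/ltW].
suff : ~~ ((f x < f p) || (f y < f p)).
  by move/norP => [nx ny]; case: hx hy => [->|hx] [->|hy] //; rewrite ?hx ?hy in nx ny.
apply/negP => /(mix_lt t0 t1 (le_fp _ hx) (le_fp _ hy)).
by rewrite -fe ltxx.
Qed.

Definition mkpoint (x y : R) : plane R := \row_j (if j == 0 then x else y).

Lemma mkpointE x y : (mkpoint x y 0 0 = x) * (mkpoint x y 0 1 = y).
Proof. by rewrite !mxE. Qed.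

Variable d : R.
Hypothesis d_bounds : 0 < d < 1.

(* A thin kite: the labels (false, b) are the ends (0, 1), (0, -1) of the short
   diagonal, (true, true) is the far apex and (true, false) the near one. *)
Definition kite (l : bool * bool) : plane R :=
  match l with
  | (false, true) => mkpoint 0 1
  | (false, false) => mkpoint 0 (-1)
  | (true, true) => mkpoint d^-1 0
  | (true, false) => mkpoint (- d) 0
  end.

(* The angle at p between q and r exceeds pi / 2 - o(1) as d tends to 0. *)
Definition wide (q p r : bool * bool) : bool :=
  (p == (true, false)) || (~~ p.1 && ((q == (true, true)) || (r == (true, true)))).

(** The near apex is wide at any inner position. If it is an end of the path, some inner vertex on
    the short diagonal is next to the far apex. *)
Lemma wide_path a b c e : uniq [:: a; b; c; e] -> wide a b c || wide b c e.
Proof.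
by move: a b c e => [[] []] [[] []] [[] []] [[] []].
Qed.

Lemma kite_wide (c : R) (q p r : bool * bool) : d < c -> uniq [:: q; p; r] -> wide q p r ->
  dot (kite q - kite p) (kite r - kite p) <
    c * (enorm (kite q - kite p) * enorm (kite r - kite p)).
Proof.
case/andP: d_bounds => d0 d1 dc; have c0 := lt_trans d0 dc.
have dV : d * d^-1 = 1 by rewrite divff ?gt_eqF.
have dV0 : 0 < d^-1 by rewrite invr_gt0.
(* Explicit lower bounds [m], [n] replace the norms, which removes the square roots. *)
have bound u v (m n : R) : 0 <= m -> 0 <= n -> m ^+ 2 <= dot u u ->
    n ^+ 2 <= dot v v -> dot u v < c * (m * n) -> dot u v < c * (enorm u * enorm v).
  move=> m0 n0 mu nv /lt_le_trans; apply; rewrite ler_wpM2l ?(ltW c0) //.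
  by apply: ler_pM => //; apply: enorm_geP.
(* Symmetry in [q] and [r] leaves seven cases. *)
wlog far : q r / (q == (true, true)) || ((r != (true, true)) && q.2).
  move=> wl uq w; have [|nfar] := boolP ((q == (true, true)) || ((r != (true, true)) && q.2)).
    by move=> far; apply: wl.
  rewrite dotC [enorm _ * _]mulrC; apply: wl.
  - move: p q r nfar uq w => [[] []] [[] []] [[] []] //.
  - move: p q r uq {nfar w} => [[] []] [[] []] [[] []] //.
  - move: p q r w {nfar uq} => [[] []] [[] []] [[] []] //.
move=> uq w; move: p q r far uq w => [[] []] [[] []] [[] []] //= _ _ _.
all: move: dV dV0; set L := d^-1 => dL L0.
all: have cdL : 0 < (c - d) * L by rewrite mulr_gt0 ?subr_gt0.
all: have cdd : 0 < (c - d) * d by rewrite mulr_gt0 ?subr_gt0.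
all: have dd : 0 < d * d /\ 0 < L * L by split; apply: mulr_gt0.
- by apply: (bound _ _ (L + d) 1); rewrite ?dotE ?mxE /=; lra.
- by apply: (bound _ _ (L + d) 1); rewrite ?dotE ?mxE /=; lra.
- by apply: (bound _ _ 1 1); rewrite ?dotE ?mxE /=; nra.
- by apply: (bound _ _ 1 1); rewrite ?dotE ?mxE /=; lra.
- by apply: (bound _ _ L 2); rewrite ?dotE ?mxE /=; lra.
- by apply: (bound _ _ 1 1); rewrite ?dotE ?mxE /=; lra.
- by apply: (bound _ _ L 2); rewrite ?dotE ?mxE /=; lra.
Qed.

Lemma kite_inj : injective kite.
Proof.
have /andP[d0 _] := d_bounds; have dV0 : 0 < d^-1 by rewrite invr_gt0.
move=> [[] []] [[] []] // /matrixP e; move: (e 0 0) (e 0 1) => {e};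
  rewrite /kite !mkpointE => ? ?; exfalso; lra.
Qed.

Definition kite_set : {fset plane R} := [fset kite l | l in {: bool * bool}]%fset.

Lemma kite_setP p : reflect (exists l, p = kite l) (p \in kite_set).
Proof.
by apply: (iffP (imfsetP _ _ _ _)) => [[l _ ->]|[l ->]]; exists l.
Qed.

Lemma kite_convex : convex_position kite_set.
Proof.
have /andP[d0 _] := d_bounds; have dV0 : 0 < d^-1 by rewrite invr_gt0.
move=> p pS; have /kite_setP [l pl] := pS.
(* Each vertex strictly maximises one coordinate up to sign. *)
pose w : R * R := match l with
  | (false, true) => (0, 1) | (false, false) => (0, -1)
  | (true, true) => (1, 0) | (true, false) => (-1, 0) end.
apply: (extreme_linear (a := w.1) (b := w.2)) => // q /kite_setP [l' ->].
rewrite pl /w {pl w} => /eqP ne.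
by move: l l' ne => [[] []] [[] []] // _; rewrite /= !mxE /=; lra.
Qed.

Lemma kite_not_open (c : R) (e : rel kite_set) :
  0 <= c < pi -> d < cos c -> is_spanning_path e -> openness e < 2 * pi - c.
Proof.
move=> cpi dc [s [us sS eE]].
have /choice [lab labE] (p : kite_set) : exists l, val p = kite l.
  exact/kite_setP/fsvalP.
have lab_inj : injective lab.
  by move=> p q pq; apply/val_inj; rewrite !labE pq.
have lab_onto l : l \in map lab s.
  have lS : kite l \in kite_set by apply/kite_setP; exists l.
  apply/mapP; exists [` lS]%fset => //.
  by apply: kite_inj; rewrite -labE.
have ul : uniq (map lab s) by rewrite map_inj_uniq.
have size_s : size s = 4.
  rewrite -(size_map lab) -(card_uniqP ul) (eq_card (B := {: bool * bool})) //.
  by rewrite card_prod card_bool.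
case: s us sS eE lab_onto ul size_s => [|x1 [|x2 [|x3 [|x4 []]]]] // us sS eE _ ul _.
have {}eE (p q : kite_set) : e p q = path_rel [:: x1; x2; x3; x4] p q by exact: eE.
have irr : irreflexive e by move=> p; rewrite eE path_rel_irr.
set s := [:: x1; x2; x3; x4] in us eE.
have low t : (0 < t)%N -> (t.+1 < 4)%N ->
    wide (lab (nth x1 s t.-1)) (lab (nth x1 s t)) (lab (nth x1 s t.+1)) ->
    openness e < 2 * pi - c.
  move=> t0 t4 w; apply: le_lt_trans (bigmin_le _ (nth x1 s t) _) _.
  apply: (@openness_at_lt _ _ _ _ (nth x1 s t.-1) (nth x1 s t.+1)) => //.
  - by rewrite eE path_rel_sym -{2}(prednK t0) path_rel_nthS //= prednK //; lia.
  - by rewrite eE path_rel_nthS.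
  - by rewrite nth_uniq //=; lia.
  - move=> y; rewrite eE => /(path_rel_neighbour us) [|u _ [ut ->]]; first by rewrite /=; lia.
    by case: ut => [->|->]; [right | left].
  rewrite !labE; apply: kite_wide => //.
  rewrite (_ : [:: _; _; _] = map lab [:: nth x1 s t.-1; nth x1 s t; nth x1 s t.+1]) //.
  by rewrite map_inj_uniq // !cons_uniq !inE !nth_uniq //=; lia.
(* Positions 1 and 2 are the inner vertices of the path. *)
by have /orP[w|w] := wide_path ul; [apply: (low 1%N) | apply: (low 2%N)].
Qed.

End Kite.

Theorem theorem4 (R : realType) :
  (forall S : {fset plane R}, S != fset0 -> convex_position S ->
     exists e : rel S,
       plane_spanning_path e /\ phi_open (3 * pi / 2) e) /\
  (forall eps : R, 0 < eps ->
     exists S : {fset plane R},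
       [/\ S != fset0, convex_position S &
           forall e : rel S, plane_spanning_path e ->
             openness e < 3 * pi / 2 + eps]).
Proof.
split=> [S|eps eps0]; first exact: convex_position_open_path.
(* The cap 1 <= pi / 2 keeps [c] below nonnegative. *)
have pi2 := pi_ge2 R; pose eps' := Num.min eps 1.
have [e0 e1 eps'_le] : [/\ 0 < eps', eps' <= 1 & eps' <= eps].
  by rewrite /eps' lt_min eps0 ltr01 ge_min lexx orbT ge_min lexx.
(* Chosen so that 2 pi - c = 3 pi / 2 + eps'. *)
pose c := pi / 2 - eps'.
have cos_c : 0 < cos c.
  by rewrite /c -cosN opprB cosBpihalf sin_gt0_pi // e0 /=; lra.
pose d := Num.min (cos c) 1 / 2.
have [d0 d1 dc] : [/\ 0 < d, d < 1 & d < cos c].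
  have : 0 < Num.min (cos c) 1 by rewrite lt_min cos_c ltr01.
  have : Num.min (cos c) 1 <= cos c by rewrite ge_min lexx.
  have : Num.min (cos c) 1 <= 1 by rewrite ge_min lexx orbT.
  by rewrite /d => ? ? ?; split; lra.
have d01 : 0 < d < 1 by rewrite d0 d1.
exists (kite_set d); split; last 1 first.
- move=> e [_ path_e].
  have cpi : 0 <= c < pi by rewrite /c; apply/andP; split; lra.
  by have := kite_not_open d01 cpi dc path_e; rewrite /c; lra.
- by apply/fset0Pn; exists (kite d (true, true)); apply/kite_setP; exists (true, true).
exact: kite_convex.
Qed.
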